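(* Let $E_\alpha(z)=\sum_{k=0}^\infty \frac{z^k}{\Gamma(\alpha k+1)}$ denote the Mittag-Leffler function, $\alpha>0$. For $0<\alpha<1$, \[ E_\alpha((x+y)^\alpha)\le E_\alpha(x^\alpha)E_\alpha(y^\alpha),\qquad x,y\ge 0, \] and for $\alpha>1$, \[ E_\alpha((x+y)^\alpha)\ge E_\alpha(x^\alpha)E_\alpha(y^\alpha),\qquad x,y\ge 0. \] Both inequalities are strict whenever $x>0$ and $y>0$. *)

(* Defs.v *)
From Stdlib Require Import Reals.
From Coquelicot Require Import Coquelicot.
Open Scope R_scope.

(* Real power x^a for x >= 0, with the convention 0^a = 0 (a > 0).
   (Stdlib's Rpower 0 a = exp (a * ln 0) = 1, so we guard x <= 0.) *)
Definition rpow (x a : R) : R :=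
  if Rle_dec x 0 then 0 else Rpower x a.

Definition Gamma (s : R) : R :=
  RInt_gen (fun t => Rpower t (s - 1) * exp (- t))
           (at_right 0) (Rbar_locally p_infty).

Definition ML (alpha z : R) : R :=
  Series (fun k => z ^ k / Gamma (alpha * INR k + 1)).

(* Main.v *)
Require Import Defs.
From Stdlib Require Import Reals Lra Lia.
From Coquelicot Require Import Coquelicot.
Open Scope R_scope.

(** Put [p_n(t) = t^(a n) / Gamma (a n + 1)], so that [E_a(t^a)] is the sum of the [p_n(t)].
    The comparison holds term by term between [p_n(x + y)] and the Cauchy product
    [sum_j p_j(x) p_(n-j)(y)], by induction on [n].  Indeed [p_(n+1)] is the
    Riemann-Liouville integral of order [a] of [p_n], that is
    [Gamma (a + 1) p_(n+1)(t) = int_0^(t^a) p_n(t - v^(1/a)) dv].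
    For [t = x + y], split this integral at [v = y^a]: the first part is controlled by the
    induction hypothesis, and the second is compared with [Gamma (a + 1) p_(n+1)(x)] through
    the sub- or superadditivity of [u^a] and [u^(1/a)].  The term [n = 1] is strict.
    The integral formula is Euler's beta-gamma relation, obtained as in Bohr-Mollerup:
    the quotient of both sides is 1-periodic and monotonicity forces it to tend to 1. *)

(** * Real powers and improper integrals over [(0, +oo)] *)

Lemma Rpower_pos (x a : R) : 0 < Rpower x a.
Proof. apply exp_pos. Qed.

Lemma is_derive_Rpower (x a : R) :
  0 < x -> is_derive (fun t => Rpower t a) x (a * Rpower x (a - 1)).
Proof. intros Hx. apply is_derive_Reals, derivable_pt_lim_power, Hx. Qed.

Lemma continuous_Rpower (x a : R) : 0 < x -> continuous (fun t => Rpower t a) x.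
Proof.
intros Hx. apply (ex_derive_continuous (V := R_NormedModule)). eexists. now apply is_derive_Rpower.
Qed.

Lemma ex_RInt_continuous_pos (h : R -> R) (a b : R) :
  (forall t, 0 < t -> continuous h t) -> 0 < a -> 0 < b -> ex_RInt h a b.
Proof.
intros Hc Ha Hb. apply (ex_RInt_continuous (V := R_CompleteNormedModule)).
intros z [Hz _]. apply Hc. apply Rlt_le_trans with (2 := Hz).
now apply Rmin_glb_lt.
Qed.

Lemma RInt_nonneg_mono (h : R -> R) (a a' b' b : R) :
  (forall t, 0 < t -> continuous h t) -> (forall t, 0 < t -> 0 <= h t) ->
  0 < a -> a <= a' -> a' <= b' -> b' <= b -> RInt h a' b' <= RInt h a b.
Proof.
intros Hc Hpos H0 H1 H2 H3.
rewrite <- (RInt_Chasles h a a' b) by (apply ex_RInt_continuous_pos; auto; lra).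
rewrite <- (RInt_Chasles h a' b' b) by (apply ex_RInt_continuous_pos; auto; lra).
assert (0 <= RInt h a a').
{ apply RInt_ge_0; [lra | apply ex_RInt_continuous_pos; auto; lra | intros; apply Hpos; lra]. }
assert (0 <= RInt h b' b).
{ apply RInt_ge_0; [lra | apply ex_RInt_continuous_pos; auto; lra | intros; apply Hpos; lra]. }
unfold plus; simpl. lra.
Qed.

(** The limit is the supremum of the integrals over compact intervals, which grow with the interval.
    That they stay below the limit is recorded too: it later gives positivity and lower bounds for
    [Gamma]. *)
Lemma ex_RInt_gen_nonneg (h : R -> R) (M : R) :
  (forall t, 0 < t -> continuous h t) -> (forall t, 0 < t -> 0 <= h t) ->
  (forall a b, 0 < a < b -> RInt h a b <= M) ->
  exists l, is_RInt_gen h (at_right 0) (Rbar_locally p_infty) l /\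
            forall a b, 0 < a < b -> RInt h a b <= l.
Proof.
intros Hc Hpos HM.
pose (E := fun v => exists a b, 0 < a < b /\ v = RInt h a b).
destruct (completeness E) as [l [Hub Hlub]].
- exists M. intros v (a & b & Hab & ->). now apply HM.
- exists (RInt h 1 2). exists 1, 2. split; [lra | reflexivity].
- assert (Hle : forall a b, 0 < a < b -> RInt h a b <= l).
  { intros a b Hab. apply Hub. exists a, b. split; [exact Hab | reflexivity]. }
  exists l. split; [| exact Hle].
  intros P [eps HP].
  assert (Hex : exists a b, 0 < a < b /\ l - eps < RInt h a b).
  { apply Classical_Prop.NNPP. intros Hn.
    assert (l <= l - eps).
    { apply Hlub. intros v (a & b & Hab & ->).
      apply Rnot_lt_le. intros Hlt. apply Hn. now exists a, b. }
    destruct eps as [e He]; simpl in *; lra. }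
  destruct Hex as (a0 & b0 & Hab & Hl).
  (* Every interval containing [[a0, b0]] has its integral in [(l - eps, l]]. *)
  exists (fun a => 0 < a <= a0) (fun b => b0 <= b).
  + exists (mkposreal a0 (proj1 Hab)). intros y Hy H0.
    unfold ball in Hy; simpl in Hy; unfold AbsRing_ball in Hy; simpl in Hy.
    unfold abs, minus, plus, opp in Hy; simpl in Hy.
    rewrite Rabs_pos_eq in Hy; lra.
  + exists b0. intros; lra.
  + intros a b Ha Hb; simpl. exists (RInt h a b). split.
    * apply (RInt_correct (V := R_CompleteNormedModule)), ex_RInt_continuous_pos; auto; lra.
    * apply HP. unfold ball; simpl; unfold AbsRing_ball; simpl.
      unfold abs, minus, plus, opp; simpl.
      assert (RInt h a0 b0 <= RInt h a b) by (apply RInt_nonneg_mono; auto; lra).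
      assert (RInt h a b <= l) by (apply Hle; lra).
      apply Rabs_def1; destruct eps as [e He]; simpl in *; lra.
Qed.

Lemma is_RInt_gen_0_infty_unique (f : R -> R) (l l' : R) :
  is_RInt_gen f (at_right 0) (Rbar_locally p_infty) l ->
  is_RInt_gen f (at_right 0) (Rbar_locally p_infty) l' -> l = l'.
Proof.
intros Hl Hl'. transitivity (RInt_gen f (at_right 0) (Rbar_locally p_infty)).
- symmetry. apply is_RInt_gen_unique, Hl.
- apply is_RInt_gen_unique, Hl'.
Qed.

(** Taking [f] as its own majorant in the norm inequality for improper integrals gives
    [|l| <= l]. *)
Lemma is_RInt_gen_nonneg (f : R -> R) (l : R) :
  (forall t, 0 < t -> 0 <= f t) ->
  is_RInt_gen f (at_right 0) (Rbar_locally p_infty) l -> 0 <= l.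
Proof.
intros Hf Hl.
assert (H : norm l <= l).
{ apply (RInt_gen_norm (V := R_CompleteNormedModule) (Fa := at_right 0)
    (Fb := Rbar_locally p_infty) f f l l); try exact Hl.
  - exists (fun a => a < 1) (fun b => 1 < b).
    + exists (mkposreal 1 Rlt_0_1). intros y Hy _.
      unfold ball in Hy; simpl in Hy; unfold AbsRing_ball in Hy; simpl in Hy.
      unfold abs, minus, plus, opp in Hy; simpl in Hy.
      apply Rabs_def2 in Hy. lra.
    + exists 1. intros; lra.
    + simpl; intros; lra.
  - exists (fun a => 0 < a) (fun b => True).
    + exists (mkposreal 1 Rlt_0_1). intros y _ Hy. exact Hy.
    + exists 1. intros; exact I.
    + simpl; intros a b Ha _ x Hx. unfold norm; simpl; unfold abs; simpl.
      rewrite Rabs_pos_eq; [lra |]. apply Hf; lra. }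
unfold norm in H; simpl in H; unfold abs in H; simpl in H.
pose proof (Rabs_pos l). lra.
Qed.

(** * The Gamma function on [[1, +oo)]: convergence, functional equation, correlation *)

(** Half of the exponential absorbs the power: for [p > 0], [ln u <= u - 1] at [u = t / (2 p)] gives
    [p ln t <= p ln (2 p) + t / 2 - p]. *)
Lemma Rpower_exp_bound (p : R) :
  0 <= p -> exists C, forall t, 0 < t -> Rpower t p * exp (- t) <= exp C * exp (- t / 2).
Proof.
intros [Hp | <-].
- exists (p * ln (2 * p)). intros t Ht. unfold Rpower. rewrite <- 2!exp_plus.
  assert (H : ln t <= ln (2 * p) + (t / (2 * p) - 1)).
  { replace t with ((2 * p) * (t / (2 * p))) at 1 by (field; lra).
    rewrite ln_mult; [| lra | apply Rdiv_lt_0_compat; lra].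
    apply Rplus_le_compat_l.
    assert (Hq : 0 < t / (2 * p)) by (apply Rdiv_lt_0_compat; lra).
    rewrite <- (exp_ln (t / (2 * p))) at 2 by exact Hq.
    pose proof (exp_ineq1_le (ln (t / (2 * p)))). lra. }
  assert (H' : p * ln t <= p * ln (2 * p) + (t / 2 - p)).
  { apply Rle_trans with (p * (ln (2 * p) + (t / (2 * p) - 1))).
    - apply Rmult_le_compat_l; lra.
    - apply Req_le. field. lra. }
  apply Rnot_lt_le. intros Hlt. apply exp_lt_inv in Hlt. lra.
- exists 0. intros t Ht. rewrite Rpower_O by exact Ht. rewrite exp_0, 2!Rmult_1_l.
  apply Rnot_lt_le. intros Hlt. apply exp_lt_inv in Hlt. lra.
Qed.

Lemma continuous_Gamma_integrand (p t : R) :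
  0 < t -> continuous (fun t => Rpower t p * exp (- t)) t.
Proof.
intros Ht. apply (continuous_mult (K := R_AbsRing)).
- now apply continuous_Rpower.
- apply (ex_derive_continuous (V := R_NormedModule)). auto_derive. exact I.
Qed.

Lemma Gamma_integrand_pos (p t : R) : 0 < Rpower t p * exp (- t).
Proof. apply Rmult_lt_0_compat; apply exp_pos. Qed.

(** The majorant [exp C * exp (- t / 2)] has integral at most [2 exp C] over any interval of
    [(0, +oo)]. The range [p >= 0] covers all arguments [a n + 1] of the series. *)
Lemma Gamma_spec (p : R) :
  0 <= p ->
  is_RInt_gen (fun t => Rpower t p * exp (- t))
    (at_right 0) (Rbar_locally p_infty) (Gamma (p + 1)) /\
  forall a b, 0 < a < b -> RInt (fun t => Rpower t p * exp (- t)) a b <= Gamma (p + 1).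
Proof.
intros Hp. destruct (Rpower_exp_bound p Hp) as [C HC].
destruct (ex_RInt_gen_nonneg (fun t => Rpower t p * exp (- t))) with (M := exp C * 2)
  as [l [Hl Hle]].
- apply continuous_Gamma_integrand.
- intros t _. apply Rlt_le, Gamma_integrand_pos.
- intros a b Hab.
  assert (HI : is_RInt (fun t => exp C * exp (- t / 2)) a b
     (exp C * (- 2 * exp (- b / 2)) - exp C * (- 2 * exp (- a / 2)))).
  { apply (is_RInt_derive (fun t => exp C * (- 2 * exp (- t / 2)))).
    - intros x _. auto_derive; [exact I | unfold Rdiv; field].
    - intros x _. apply (ex_derive_continuous (V := R_NormedModule)). auto_derive. exact I. }
  apply Rle_trans with (RInt (fun t => exp C * exp (- t / 2)) a b).
  + apply RInt_le; [lra | | now eexists; exact HI | intros; apply HC; lra].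
    apply (ex_RInt_continuous (V := R_CompleteNormedModule)). intros z Hz.
    apply continuous_Gamma_integrand. rewrite Rmin_left in Hz; lra.
  + rewrite (is_RInt_unique _ _ _ _ HI).
    pose proof (exp_pos C). pose proof (exp_pos (- b / 2)).
    assert (exp (- a / 2) <= 1).
    { rewrite <- exp_0. apply Rlt_le, exp_increasing. lra. }
    nra.
- assert (HG : Gamma (p + 1) = l).
  { unfold Gamma. replace (p + 1 - 1) with p by ring.
    apply is_RInt_gen_unique, Hl. }
  rewrite HG. now split.
Qed.

Lemma Gamma_pos (p : R) : 0 <= p -> 0 < Gamma (p + 1).
Proof.
intros Hp. destruct (Gamma_spec p Hp) as [_ H].
apply Rlt_le_trans with (2 := H 1 2 ltac:(lra)).
apply RInt_gt_0; [lra | intros; apply Gamma_integrand_pos |].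
intros x Hx. apply continuous_Gamma_integrand. lra.
Qed.

(** Only the mass on [[A, A + 1]] is kept. As [A] is free, [Gamma] outgrows every geometric
    sequence, whence the convergence of the series. *)
Lemma Gamma_lower (p A : R) : 0 <= p -> 0 < A -> Rpower A p * exp (- (A + 1)) <= Gamma (p + 1).
Proof.
intros Hp HA. destruct (Gamma_spec p Hp) as [_ H].
apply Rle_trans with (2 := H A (A + 1) ltac:(lra)).
replace (Rpower A p * exp (- (A + 1)))
  with (RInt (fun _ => Rpower A p * exp (- (A + 1))) A (A + 1)).
- apply RInt_le; [lra | apply ex_RInt_const | |].
  + apply (ex_RInt_continuous (V := R_CompleteNormedModule)). intros z Hz.
    apply continuous_Gamma_integrand. rewrite Rmin_left in Hz; lra.
  + intros x Hx. apply Rmult_le_compat; try (apply Rlt_le, exp_pos).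
    * apply Rle_Rpower_l; lra.
    * apply Rlt_le, exp_increasing. lra.
- rewrite RInt_const. unfold scal; simpl; unfold mult; simpl. ring.
Qed.

Lemma filter_prod_pos (P : R -> Prop) :
  (forall t, 0 < t -> P t) ->
  filter_prod (at_right 0) (Rbar_locally p_infty)
    (fun ab => forall x, Rmin (fst ab) (snd ab) <= x <= Rmax (fst ab) (snd ab) -> P x).
Proof.
intros HP. exists (fun a => 0 < a) (fun b => 0 < b).
- exists (mkposreal 1 Rlt_0_1). intros y _ Hy. exact Hy.
- exists 0. intros; lra.
- simpl; intros a b Ha Hb x [Hx _]. apply HP.
  apply Rlt_le_trans with (2 := Hx). now apply Rmin_glb_lt.
Qed.

Lemma is_RInt_gen_antiderivative (F f : R -> R) (la lb : R) :
  (forall t, 0 < t -> is_derive F t (f t)) ->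
  (forall t, 0 < t -> continuous f t) ->
  filterlim F (at_right 0) (locally la) ->
  filterlim F (Rbar_locally p_infty) (locally lb) ->
  is_RInt_gen f (at_right 0) (Rbar_locally p_infty) (lb - la).
Proof.
intros HF Hf Ha Hb.
assert (HD : forall t, 0 < t -> Derive F t = f t).
{ intros t Ht. now apply is_derive_unique, HF. }
apply (is_RInt_gen_ext (V := R_NormedModule)) with (f := Derive F).
- generalize (filter_prod_pos _ HD). apply filter_imp.
  intros [a b] H x Hx. simpl in *. apply H. lra.
- apply is_RInt_gen_Derive; try assumption.
  + apply filter_prod_pos. intros t Ht. eexists. now apply HF.
  + apply filter_prod_pos. intros t Ht.
    apply continuous_ext_loc with f; [| now apply Hf].
    exists (mkposreal t Ht). intros y Hy. symmetry. apply HD.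
    unfold ball in Hy; simpl in Hy; unfold AbsRing_ball in Hy; simpl in Hy.
    unfold abs, minus, plus, opp in Hy; simpl in Hy. apply Rabs_def2 in Hy. lra.
Qed.

Lemma Gamma_1 : Gamma 1 = 1.
Proof.
replace (Gamma 1) with (Gamma (0 + 1)) by (f_equal; ring).
assert (H := proj1 (Gamma_spec 0 (Rle_refl 0))).
assert (H1 : is_RInt_gen (fun t => exp (- t)) (at_right 0) (Rbar_locally p_infty) (0 - - 1)).
{ apply is_RInt_gen_antiderivative with (F := fun t => - exp (- t)).
  - intros t _. auto_derive; [exact I | ring].
  - intros t _. apply (ex_derive_continuous (V := R_NormedModule)). auto_derive. exact I.
  - apply (filterlim_filter_le_1 (F := locally 0)).
    { intros P [e He]. exists e. intros y Hy _. now apply He. }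
    replace (- 1) with (- exp (- 0)) by (rewrite Ropp_0, exp_0; ring).
    apply (ex_derive_continuous (V := R_NormedModule) (fun t => - exp (- t))).
    auto_derive. exact I.
  - apply (is_lim_ext (fun t => - exp (- t)) _ p_infty 0); [reflexivity |].
    evar_last; [apply is_lim_opp, is_lim_comp with m_infty; [apply is_lim_exp_m | |] |].
    + evar_last; [apply is_lim_opp, is_lim_id | reflexivity].
    + exists 0. discriminate.
    + simpl. f_equal. ring. }
assert (H2 : is_RInt_gen (fun t => Rpower t 0 * exp (- t)) (at_right 0)
   (Rbar_locally p_infty) (0 - - 1)).
{ revert H1. apply (is_RInt_gen_ext (V := R_NormedModule)).
  assert (H0 : forall t, 0 < t -> exp (- t) = Rpower t 0 * exp (- t)).
  { intros t Ht. rewrite Rpower_O by exact Ht. ring. }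
  generalize (filter_prod_pos _ H0). apply filter_imp.
  intros [a b] Hab x Hx. simpl in *. apply Hab. lra. }
rewrite (is_RInt_gen_0_infty_unique _ _ _ H H2). ring.
Qed.

(** Integration by parts, written with an antiderivative: [- t^(p+1) e^(-t)] has derivative
    [t^(p+1) e^(-t) - (p+1) t^p e^(-t)] and tends to 0 at both ends. *)
Lemma Gamma_succ (p : R) : 0 <= p -> Gamma (p + 1 + 1) = (p + 1) * Gamma (p + 1).
Proof.
intros Hp.
assert (H := proj1 (Gamma_spec p Hp)).
assert (H' := proj1 (Gamma_spec (p + 1) ltac:(lra))).
assert (HD := is_RInt_gen_minus _ _ _ _ H' (is_RInt_gen_scal _ (p + 1) _ H)).
assert (H1 : is_RInt_gen (fun t => minus (Rpower t (p + 1) * exp (- t))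
   (scal (p + 1) (Rpower t p * exp (- t)))) (at_right 0) (Rbar_locally p_infty) (0 - 0)).
{ apply is_RInt_gen_antiderivative with (F := fun t => - (Rpower t (p + 1) * exp (- t))).
  - intros t Ht. unfold minus, plus, opp, scal; simpl; unfold mult; simpl.
    evar_last.
    + apply (is_derive_opp (V := R_NormedModule)),
        (is_derive_mult (K := R_AbsRing) (fun t => Rpower t (p + 1)) (fun t => exp (- t))).
      * now apply is_derive_Rpower.
      * auto_derive; [exact I | reflexivity].
      * intros; apply Rmult_comm.
    + unfold opp, plus, mult; simpl. replace (p + 1 - 1) with p by ring. ring.
  - intros t Ht. apply (continuous_minus (V := R_NormedModule)).
    + now apply continuous_Gamma_integrand.
    + apply (continuous_scal_r (V := R_NormedModule)). now apply continuous_Gamma_integrand.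
  - apply (filterlim_locally (F := at_right 0)). intros eps.
    (* For [0 < t < 1] both [t^p] and [e^(-t)] are at most 1, so [t^(p+1) e^(-t) <= t]; hence the
       radius [min(eps, 1)]. *)
    assert (Hm : 0 < Rmin eps 1) by (apply Rmin_glb_lt; [apply cond_pos | lra]).
    exists (mkposreal _ Hm). intros y Hy H0.
    unfold ball in *; simpl in *; unfold AbsRing_ball in *; simpl in *.
    unfold abs, minus, plus, opp in *; simpl in *.
    rewrite Rabs_pos_eq in Hy by lra.
    pose proof (Rmin_l eps 1). pose proof (Rmin_r eps 1).
    pose proof (Gamma_integrand_pos (p + 1) y).
    assert (Rpower y (p + 1) * exp (- y) <= y * 1).
    { apply Rmult_le_compat; try (apply Rlt_le, exp_pos).
      - rewrite Rpower_plus, Rpower_1 by exact H0.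
        assert (Rpower y p <= 1); [| nra].
        replace 1 with (Rpower 1 p) by (unfold Rpower; rewrite ln_1, Rmult_0_r; apply exp_0).
        apply Rle_Rpower_l; lra.
      - rewrite <- exp_0. apply Rlt_le, exp_increasing. lra. }
    apply Rabs_def1; lra.
  - destruct (Rpower_exp_bound (p + 1)) as [C HC]; [lra |].
    apply (is_lim_le_le_loc (fun t => - (exp C * exp (- t / 2))) (fun _ => 0) _ p_infty 0).
    + exists 0. intros t Ht. pose proof (HC t Ht).
      pose proof (Gamma_integrand_pos (p + 1) t). lra.
    + evar_last; [apply is_lim_opp, is_lim_scal_l, is_lim_comp with m_infty;
        [apply is_lim_exp_m | |] |].
      * apply is_lim_ext with (fun t => (- / 2) * t); [intros; field |].
        evar_last; [apply is_lim_scal_l, is_lim_id |].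
        simpl. destruct (Rle_dec 0 (- / 2)) as [h | h]; [exfalso; lra | reflexivity].
      * exists 0. discriminate.
      * simpl. f_equal. ring.
    + apply is_lim_const. }
apply (is_RInt_gen_0_infty_unique _ _ _ H1) in HD. unfold minus, plus, opp, scal in HD; simpl in HD; unfold mult in HD; simpl in HD.
lra.
Qed.

(* Chebyshev's correlation inequality for [t^a] and [t^d] under the density
   [t^c e^(-t)]: integrate [(t^a - mu) (t^d - mu^(d/a)) >= 0], [mu] being the mean of [t^a]. *)
Lemma Gamma_correlation (a c d : R) :
  0 < a -> 0 <= c -> 0 <= d ->
  Gamma (c + a + 1) * Gamma (c + d + 1) <= Gamma (c + a + d + 1) * Gamma (c + 1).
Proof.
intros Ha Hc Hd.
pose (mu := Gamma (c + a + 1) / Gamma (c + 1)).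
pose (nu := Rpower mu (d / a)).
assert (H0 := Gamma_pos c Hc).
assert (Hmu : 0 < mu) by (apply Rdiv_lt_0_compat; [apply Gamma_pos; lra | exact H0]).
assert (I0 := proj1 (Gamma_spec c Hc)).
assert (I1 := proj1 (Gamma_spec (c + a) ltac:(lra))).
assert (I2 := proj1 (Gamma_spec (c + d) ltac:(lra))).
assert (I3 := proj1 (Gamma_spec (c + a + d) ltac:(lra))).
assert (I := is_RInt_gen_plus _ _ _ _
  (is_RInt_gen_minus _ _ _ _ I3 (is_RInt_gen_scal _ mu _ I2))
  (is_RInt_gen_minus _ _ _ _ (is_RInt_gen_scal _ (mu * nu) _ I0) (is_RInt_gen_scal _ nu _ I1))).
apply is_RInt_gen_nonneg in I.
- unfold minus, plus, opp, scal in I; simpl in I; unfold mult in I; simpl in I.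
  (* By the choice of [mu], the two terms containing [nu] cancel. *)
  replace (mu * nu * Gamma (c + 1)) with (nu * Gamma (c + a + 1)) in I
    by (unfold mu; field; lra).
  assert (I' : mu * Gamma (c + d + 1) <= Gamma (c + a + d + 1)) by lra.
  apply Rmult_le_compat_r with (r := Gamma (c + 1)) in I'; [| lra].
  replace (mu * Gamma (c + d + 1) * Gamma (c + 1))
    with (Gamma (c + a + 1) * Gamma (c + d + 1)) in I' by (unfold mu; field; lra).
  exact I'.
- intros t Ht. unfold minus, plus, opp, scal; simpl; unfold mult; simpl.
  rewrite !Rpower_plus.
  replace (_ + _) with (Rpower t c * exp (- t) * ((Rpower t a - mu) * (Rpower t d - nu))) by ring.
  apply Rmult_le_pos; [apply Rlt_le, Gamma_integrand_pos |].
  (* [t^d = (t^a)^(d/a)] is nondecreasing in [t^a], so [t^a - mu] and [t^d - nu] never have opposite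
     signs. *)
  replace (Rpower t d) with (Rpower (Rpower t a) (d / a))
    by (rewrite Rpower_mult; f_equal; field; lra).
  assert (Hda : 0 <= d / a) by (apply Rdiv_le_0_compat; lra).
  unfold nu. destruct (Rle_dec (Rpower t a) mu) as [h | h].
  + assert (Rpower (Rpower t a) (d / a) <= Rpower mu (d / a)).
    { apply Rle_Rpower_l; [exact Hda | split; [apply exp_pos | exact h]]. }
    nra.
  + assert (Rpower mu (d / a) <= Rpower (Rpower t a) (d / a)).
    { apply Rle_Rpower_l; [exact Hda | lra]. }
    nra.
Qed.

(** * Guarded powers: continuity, sub- and superadditivity *)

Lemma rpow_pos (x a : R) : 0 < x -> rpow x a = Rpower x a.
Proof. intros Hx. unfold rpow. destruct (Rle_dec x 0); [lra | reflexivity]. Qed.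

Lemma rpow_nonpos (x a : R) : x <= 0 -> rpow x a = 0.
Proof. intros Hx. unfold rpow. destruct (Rle_dec x 0); [reflexivity | lra]. Qed.

Lemma rpow_ge_0 (x a : R) : 0 <= rpow x a.
Proof. unfold rpow. destruct (Rle_dec x 0); [lra | apply Rlt_le, exp_pos]. Qed.

Lemma rpow_gt_0 (x a : R) : 0 < x -> 0 < rpow x a.
Proof. intros Hx. rewrite rpow_pos by exact Hx. apply exp_pos. Qed.

Lemma rpow_le (x y a : R) : 0 <= a -> x <= y -> rpow x a <= rpow y a.
Proof.
intros Ha Hxy. destruct (Rle_dec x 0) as [Hx | Hx].
- rewrite rpow_nonpos by exact Hx. apply rpow_ge_0.
- rewrite 2!rpow_pos by lra. apply Rle_Rpower_l; lra.
Qed.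

Lemma rpow_1_l (a : R) : rpow 1 a = 1.
Proof.
rewrite rpow_pos by lra. unfold Rpower. rewrite ln_1, Rmult_0_r. apply exp_0.
Qed.

Lemma rpow_rpow_inv (x a : R) : 0 < a -> 0 <= x -> rpow (rpow x a) (/ a) = x.
Proof.
intros Ha [Hx | <-].
- rewrite rpow_pos by now apply rpow_gt_0.
  rewrite rpow_pos by exact Hx. rewrite Rpower_mult, Rinv_r by lra.
  now apply Rpower_1.
- rewrite (rpow_nonpos 0 a), rpow_nonpos; lra.
Qed.

Lemma rpow_mult_l (x y a : R) : 0 < x -> rpow (x * y) a = rpow x a * rpow y a.
Proof.
intros Hx. destruct (Rle_dec y 0) as [Hy | Hy].
- rewrite (rpow_nonpos y), rpow_nonpos by nra. ring.
- assert (0 < x * y) by nra.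
  rewrite 3!rpow_pos by lra. symmetry. apply Rpower_mult_distr; lra.
Qed.

Lemma continuous_rpow (x a : R) : 0 < a -> continuous (fun t => rpow t a) x.
Proof.
intros Ha. destruct (Rtotal_order x 0) as [Hx | [-> | Hx]].
- apply (continuous_ext_loc (U := R_UniformSpace)) with (fun _ => 0).
  + generalize (open_lt 0 x Hx). apply filter_imp.
    intros y Hy. symmetry. apply rpow_nonpos. lra.
  + apply continuous_const.
- apply (filterlim_locally (F := locally 0)). intros eps.
  exists (mkposreal (Rpower eps (/ a)) (exp_pos _)). intros y Hy.
  rewrite (rpow_nonpos 0) by lra.
  unfold ball in *; simpl in *; unfold AbsRing_ball in *; simpl in *.
  unfold abs, minus, plus, opp in *; simpl in *.
  apply Rabs_def2 in Hy.
  pose proof (rpow_ge_0 y a). pose proof (cond_pos eps).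
  rewrite Rabs_pos_eq by lra.
  destruct (Rle_dec y 0) as [Hy0 | Hy0].
  + rewrite rpow_nonpos by exact Hy0. lra.
  + rewrite rpow_pos by lra.
    replace (pos eps) with (Rpower (Rpower eps (/ a)) a).
    * assert (Rpower y a < Rpower (Rpower eps (/ a)) a); [apply Rlt_Rpower_l |]; lra.
    * rewrite Rpower_mult, Rinv_l by lra. now apply Rpower_1.
- apply (continuous_ext_loc (U := R_UniformSpace)) with (fun t => Rpower t a).
  + generalize (open_gt 0 x Hx). apply filter_imp.
    intros y Hy. symmetry. now apply rpow_pos.
  + now apply continuous_Rpower.
Qed.

Lemma Rpower_lt_base_1 (u a b : R) : 0 < u < 1 -> a < b -> Rpower u b < Rpower u a.
Proof.
intros Hu Hab. apply exp_increasing.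
assert (ln u < 0) by (rewrite <- ln_1; apply ln_increasing; lra). nra.
Qed.

(** Dividing by [x + y] reduces additivity questions to two numbers of [(0, 1)] with sum 1, for
    which [u^a < u] if [a > 1] and [u < u^a] if [a < 1]. *)
Lemma rpow_split (x y a : R) :
  0 < x -> 0 < y ->
  rpow x a + rpow y a =
  rpow (x + y) a * (Rpower (x / (x + y)) a + Rpower (y / (x + y)) a).
Proof.
intros Hx Hy.
rewrite <- 2!(rpow_pos _ a) by (apply Rdiv_lt_0_compat; lra).
rewrite Rmult_plus_distr_l, <- 2!rpow_mult_l by lra.
f_equal; f_equal; field; lra.
Qed.

Lemma ratio_bounds (x y : R) : 0 < x -> 0 < y -> 0 < x / (x + y) < 1.
Proof.
intros Hx Hy. split; [apply Rdiv_lt_0_compat; lra |].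
apply Rlt_div_l; lra.
Qed.

Lemma rpow_superadditive_lt (x y a : R) :
  1 < a -> 0 < x -> 0 < y -> rpow x a + rpow y a < rpow (x + y) a.
Proof.
intros Ha Hx Hy. rewrite rpow_split by assumption.
pose proof (ratio_bounds x y Hx Hy) as Hu.
pose proof (ratio_bounds y x Hy Hx) as Hv. rewrite (Rplus_comm y x) in Hv.
pose proof (Rpower_lt_base_1 _ 1 a Hu Ha) as H1.
pose proof (Rpower_lt_base_1 _ 1 a Hv Ha) as H2.
rewrite Rpower_1 in H1, H2 by lra.
assert (x / (x + y) + y / (x + y) = 1) by (field; lra).
assert (0 < rpow (x + y) a) by (apply rpow_gt_0; lra). nra.
Qed.

Lemma rpow_subadditive_lt (x y a : R) :
  a < 1 -> 0 < x -> 0 < y -> rpow (x + y) a < rpow x a + rpow y a.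
Proof.
intros Ha Hx Hy. rewrite rpow_split by assumption.
pose proof (ratio_bounds x y Hx Hy) as Hu.
pose proof (ratio_bounds y x Hy Hx) as Hv. rewrite (Rplus_comm y x) in Hv.
pose proof (Rpower_lt_base_1 _ a 1 Hu Ha) as H1.
pose proof (Rpower_lt_base_1 _ a 1 Hv Ha) as H2.
rewrite Rpower_1 in H1, H2 by lra.
assert (x / (x + y) + y / (x + y) = 1) by (field; lra).
assert (0 < rpow (x + y) a) by (apply rpow_gt_0; lra). nra.
Qed.

Lemma rpow_superadditive (x y a : R) :
  1 < a -> 0 <= x -> 0 <= y -> rpow x a + rpow y a <= rpow (x + y) a.
Proof.
intros Ha [Hx | <-] [Hy | <-].
- now apply Rlt_le, rpow_superadditive_lt.
- rewrite (rpow_nonpos 0), 2!Rplus_0_r; lra.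
- rewrite (rpow_nonpos 0), 2!Rplus_0_l; lra.
- rewrite Rplus_0_l, (rpow_nonpos 0); lra.
Qed.

Lemma rpow_subadditive (x y a : R) :
  a < 1 -> 0 <= x -> 0 <= y -> rpow (x + y) a <= rpow x a + rpow y a.
Proof.
intros Ha [Hx | <-] [Hy | <-].
- now apply Rlt_le, rpow_subadditive_lt.
- rewrite (rpow_nonpos 0), 2!Rplus_0_r; lra.
- rewrite (rpow_nonpos 0), 2!Rplus_0_l; lra.
- rewrite Rplus_0_l, (rpow_nonpos 0); lra.
Qed.

(* [rpow] with [u^0 = 1] for every [u], hence continuous in [u] for every [c >= 0]. *)
Definition rpow0 (u c : R) : R := if Req_EM_T c 0 then 1 else rpow u c.

Lemma rpow0_pos (u c : R) : 0 < u -> rpow0 u c = Rpower u c.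
Proof.
intros Hu. unfold rpow0. destruct (Req_EM_T c 0) as [-> | _].
- symmetry. now apply Rpower_O.
- now apply rpow_pos.
Qed.

Lemma rpow0_ge_0 (u c : R) : 0 <= rpow0 u c.
Proof. unfold rpow0. destruct (Req_EM_T c 0); [lra | apply rpow_ge_0]. Qed.

Lemma rpow0_le (u v c : R) : 0 <= c -> u <= v -> rpow0 u c <= rpow0 v c.
Proof.
intros Hc Huv. unfold rpow0. destruct (Req_EM_T c 0); [lra | now apply rpow_le].
Qed.

Lemma rpow0_mult_l (x y c : R) : 0 < x -> rpow0 (x * y) c = rpow0 x c * rpow0 y c.
Proof.
intros Hx. unfold rpow0. destruct (Req_EM_T c 0); [ring | now apply rpow_mult_l].
Qed.

Lemma continuous_rpow0 (u c : R) : 0 <= c -> continuous (fun t => rpow0 t c) u.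
Proof.
intros Hc. unfold rpow0. destruct (Req_EM_T c 0).
- apply continuous_const.
- apply continuous_rpow. lra.
Qed.

(** The reason for [rpow0]: at [n = 0] the series has [z^0 = 1] even for [z = 0], where [rpow] would
    give 0. *)
Lemma rpow_pow (t a : R) (n : nat) : 0 < a -> rpow t a ^ n = rpow0 t (a * INR n).
Proof.
intros Ha. unfold rpow0. destruct (Req_EM_T (a * INR n) 0) as [H0 | H0].
- destruct n as [| n]; [reflexivity |].
  exfalso. pose proof (lt_0_INR (S n) (Nat.lt_0_succ n)). nra.
- destruct (Rle_dec t 0) as [Ht | Ht].
  + rewrite 2!rpow_nonpos by exact Ht. apply pow_ne_zero.
    intros ->. simpl in H0. lra.
  + rewrite 2!rpow_pos by lra. rewrite <- Rpower_pow by apply exp_pos.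
    apply Rpower_mult.
Qed.

(** * The beta integral and its relation to Gamma *)

(** Differentiability is asked only inside the interval, because the antiderivative used in
    [beta_int_succ] has a corner at [w = 1] when [c = 0]. The mean value theorem is applied to
    [RInt g a x - F x], whose derivative is zero inside. *)
Lemma RInt_antiderivative (F g : R -> R) (a b : R) :
  a < b ->
  (forall x, a < x < b -> is_derive F x (g x)) ->
  (forall x, a <= x <= b -> continuous F x) ->
  (forall x, continuous g x) ->
  RInt g a b = F b - F a.
Proof.
intros Hab HF HFc Hg.
assert (HG : forall x, is_derive (RInt g a) x (g x)).
{ intros x. apply (is_derive_RInt (V := R_NormedModule) _ _ a); [| apply Hg].
  apply filter_forall. intros y.
  apply (RInt_correct (V := R_CompleteNormedModule)).
  apply (ex_RInt_continuous (V := R_CompleteNormedModule)). intros; apply Hg. }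
destruct (MVT_gen (fun x => minus (RInt g a x) (F x)) a b (fun _ => 0)) as (c & _ & Hc).
- intros x Hx. rewrite Rmin_left, Rmax_right in Hx by lra.
  replace 0 with (minus (g x) (g x)) by (unfold minus, plus, opp; simpl; ring).
  apply (is_derive_minus (V := R_NormedModule)); [apply HG | now apply HF].
- intros x Hx. rewrite Rmin_left, Rmax_right in Hx by lra.
  apply continuity_pt_filterlim.
  apply (continuous_minus (V := R_NormedModule)); [| now apply HFc].
  apply (ex_derive_continuous (V := R_NormedModule)). eexists. apply HG.
- rewrite RInt_point in Hc. unfold minus, plus, opp, zero in Hc; simpl in Hc. lra.
Qed.

(* In terms of Euler's beta function this is [B(1/b, c + 1) / b]. *)
Definition beta_int (b c : R) : R := RInt (fun w => rpow0 (1 - rpow w b) c) 0 1.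

Lemma continuous_beta_integrand (b c w : R) :
  0 < b -> 0 <= c -> continuous (fun w => rpow0 (1 - rpow w b) c) w.
Proof.
intros Hb Hc. apply continuous_comp with (g := fun u => rpow0 u c).
- apply (continuous_minus (V := R_NormedModule)).
  + apply continuous_const.
  + now apply continuous_rpow.
- now apply continuous_rpow0.
Qed.

Lemma ex_RInt_beta_integrand (b c u v : R) :
  0 < b -> 0 <= c -> ex_RInt (fun w => rpow0 (1 - rpow w b) c) u v.
Proof.
intros Hb Hc. apply (ex_RInt_continuous (V := R_CompleteNormedModule)).
intros; now apply continuous_beta_integrand.
Qed.

Lemma beta_base_bounds (b w : R) : 0 < b -> 0 < w < 1 -> 0 < 1 - Rpower w b < 1.
Proof.
intros Hb Hw. pose proof (Rpower_pos w b).
pose proof (Rpower_lt_base_1 w 0 b Hw Hb) as H1. rewrite Rpower_O in H1; lra.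
Qed.

(** [1 - w^b] lies in [(0, 1)], where powers decrease in the exponent. *)
Lemma beta_int_decr (b c d : R) : 0 < b -> 0 <= c <= d -> beta_int b d <= beta_int b c.
Proof.
intros Hb Hcd. apply RInt_le; [lra | apply ex_RInt_beta_integrand; lra .. |].
intros w Hw. pose proof (beta_base_bounds b w Hb Hw).
rewrite (rpow_pos w) by lra. rewrite 2!rpow0_pos by lra.
destruct (Req_dec c d) as [-> | Hne]; [lra |].
apply Rlt_le, Rpower_lt_base_1; lra.
Qed.

Lemma beta_int_0 (b : R) : beta_int b 0 = 1.
Proof.
unfold beta_int, rpow0. destruct (Req_EM_T 0 0); [| lra].
rewrite RInt_const. unfold scal; simpl; unfold mult; simpl. ring.
Qed.

(** [w (1 - w^b)^(c+1)] vanishes at 0 and 1. Writing [w^b = 1 - (1 - w^b)] in its derivative turns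
    the latter into the combination [g] of the two integrands. *)
Lemma beta_int_succ (b c : R) :
  0 < b -> 0 <= c -> (1 + (c + 1) * b) * beta_int b (c + 1) = (c + 1) * b * beta_int b c.
Proof.
intros Hb Hc.
pose (g := fun w => minus (scal (1 + (c + 1) * b) (rpow0 (1 - rpow w b) (c + 1)))
                          (scal ((c + 1) * b) (rpow0 (1 - rpow w b) c))).
assert (HI : RInt g 0 1 = (1 + (c + 1) * b) * beta_int b (c + 1) - (c + 1) * b * beta_int b c).
{ unfold g. rewrite (RInt_minus (V := R_CompleteNormedModule)).
  - rewrite 2!(RInt_scal (V := R_CompleteNormedModule)); [reflexivity | |];
      apply ex_RInt_beta_integrand; lra.
  - apply (ex_RInt_scal (V := R_NormedModule)), ex_RInt_beta_integrand; lra.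
  - apply (ex_RInt_scal (V := R_NormedModule)), ex_RInt_beta_integrand; lra. }
rewrite (RInt_antiderivative (fun w => w * rpow0 (1 - rpow w b) (c + 1))) in HI.
- rewrite rpow_1_l in HI. replace (1 - 1) with 0 in HI by ring.
  assert (H0 : rpow0 0 (c + 1) = 0).
  { unfold rpow0. destruct (Req_EM_T (c + 1) 0); [lra |]. apply rpow_nonpos. lra. }
  rewrite H0 in HI. lra.
- lra.
- intros w Hw. pose proof (beta_base_bounds b w Hb Hw) as Hu.
  apply is_derive_ext_loc with (fun w => w * Rpower (1 - Rpower w b) (c + 1)).
  + generalize (open_and _ _ (open_gt 0) (open_lt 1) w Hw). apply filter_imp.
    intros y Hy. pose proof (beta_base_bounds b y Hb Hy).
    rewrite (rpow_pos y), rpow0_pos by lra. reflexivity.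
  + unfold g. rewrite (rpow_pos w), 2!rpow0_pos by lra.
    unfold minus, plus, opp, scal; simpl; unfold mult; simpl.
    evar_last.
    * apply (is_derive_mult (K := R_AbsRing) (fun w => w)
        (fun w => Rpower (1 - Rpower w b) (c + 1))).
      -- apply is_derive_id.
      -- apply (is_derive_comp (V := R_NormedModule) (fun u => Rpower u (c + 1))).
         ++ apply is_derive_Rpower. lra.
         ++ apply (is_derive_minus (V := R_NormedModule)); [apply is_derive_const |].
            apply is_derive_Rpower. lra.
      -- intros; apply Rmult_comm.
    * unfold minus, plus, opp, scal, zero, one; simpl; unfold mult; simpl.
      replace (c + 1 - 1) with c by ring.
      replace (Rpower (1 - Rpower w b) (c + 1))
        with (Rpower (1 - Rpower w b) c * (1 - Rpower w b))
        by (rewrite Rpower_plus, Rpower_1 by lra; reflexivity).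
      set (U := Rpower (1 - Rpower w b) c).
      replace (Rpower w b) with (Rpower w (b - 1) * w); [ring |].
      rewrite <- (Rpower_1 w) at 2 by lra. rewrite <- Rpower_plus. f_equal. ring.
- intros w _. apply (continuous_mult (K := R_AbsRing)); [apply continuous_id |].
  apply continuous_beta_integrand; lra.
- intros w. apply (continuous_minus (V := R_NormedModule));
    apply (continuous_scal_r (V := R_NormedModule)), continuous_beta_integrand; lra.
Qed.

(** The two recurrences cancel: [beta_int] gains the factor [(c + 1) / (c + a + 1)] and the Gamma
    quotient its inverse. *)
Lemma beta_Gamma_succ (a c : R) :
  0 < a -> 0 <= c ->
  beta_int (/ a) (c + 1) * Gamma (c + 1 + a + 1) / Gamma (c + 1 + 1) =
  beta_int (/ a) c * Gamma (c + a + 1) / Gamma (c + 1).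
Proof.
intros Ha Hc.
assert (Hb : 0 < / a) by now apply Rinv_0_lt_compat.
pose proof (beta_int_succ (/ a) c Hb Hc) as HK.
replace (c + 1 + a + 1) with (c + a + 1 + 1) by ring.
rewrite 2!Gamma_succ by lra.
pose proof (Gamma_pos c Hc).
replace (beta_int (/ a) (c + 1)) with ((c + 1) / (c + a + 1) * beta_int (/ a) c).
- field. lra.
- apply Rmult_eq_reg_l with (1 + (c + 1) * / a).
  + rewrite HK. field. lra.
  + assert (0 < (c + 1) * / a) by (apply Rmult_lt_0_compat; lra). lra.
Qed.

Lemma beta_Gamma_shift (a c : R) (n : nat) :
  0 < a -> 0 <= c ->
  beta_int (/ a) (c + INR n) * Gamma (c + INR n + a + 1) / Gamma (c + INR n + 1) =
  beta_int (/ a) c * Gamma (c + a + 1) / Gamma (c + 1).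
Proof.
intros Ha Hc. induction n as [| n IH].
- simpl. now rewrite Rplus_0_r.
- rewrite S_INR, <- Rplus_assoc, <- IH. apply beta_Gamma_succ; [exact Ha |].
  pose proof (pos_INR n). lra.
Qed.

(** The integers are reached by shifting from [c = 0], where the beta integral and [Gamma 1] are
    both 1. *)
Lemma beta_Gamma_INR (a : R) (n : nat) :
  0 < a ->
  beta_int (/ a) (INR n) * (Gamma (INR n + a + 1) / Gamma (INR n + 1)) = Gamma (a + 1).
Proof.
intros Ha. pose proof (beta_Gamma_shift a 0 n Ha (Rle_refl 0)) as H.
rewrite !Rplus_0_l, beta_int_0, Gamma_1 in H. unfold Rdiv in *. lra.
Qed.

(** [Gamma_correlation] with exponent increments [a] and [d - c], divided by the two
    denominators. *)
Lemma Gamma_ratio_incr (a c d : R) :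
  0 < a -> 0 <= c <= d ->
  Gamma (c + a + 1) / Gamma (c + 1) <= Gamma (d + a + 1) / Gamma (d + 1).
Proof.
intros Ha Hcd.
pose proof (Gamma_correlation a c (d - c) Ha ltac:(lra) ltac:(lra)) as H.
replace (c + (d - c) + 1) with (d + 1) in H by ring.
replace (c + a + (d - c) + 1) with (d + a + 1) in H by ring.
pose proof (Gamma_pos c ltac:(lra)). pose proof (Gamma_pos d ltac:(lra)).
apply Rle_div_l; [lra |].
replace (Gamma (d + a + 1) / Gamma (d + 1) * Gamma (c + 1))
  with (Gamma (d + a + 1) * Gamma (c + 1) / Gamma (d + 1)) by (field; lra).
apply Rle_div_r; lra.
Qed.

(** The beta integral decreases in [c] and the Gamma quotient increases, so their product is bounded
    by mixed products of values at [m] and [m + 1]. From [m] to [m + 1] the quotient grows only by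
    the factor [1 + a / (m + 1)], so both bounds are within relative error [a / (m + 1)] of
    [Gamma (a + 1)]. *)
Lemma beta_Gamma_sandwich (a c : R) (m : nat) :
  0 < a -> INR m <= c <= INR m + 1 ->
  Rabs (beta_int (/ a) c * Gamma (c + a + 1) / Gamma (c + 1) - Gamma (a + 1))
  <= Gamma (a + 1) * (a / (INR m + 1)).
Proof.
intros Ha Hc.
assert (Hb : 0 < / a) by now apply Rinv_0_lt_compat.
pose proof (pos_INR m) as Hm.
pose proof (beta_int_decr (/ a) (INR m) c Hb ltac:(lra)) as K1.
pose proof (beta_int_decr (/ a) c (INR m + 1) Hb ltac:(lra)) as K2.
pose proof (Gamma_ratio_incr a (INR m) c Ha ltac:(lra)) as q1.
pose proof (Gamma_ratio_incr a c (INR m + 1) Ha ltac:(lra)) as q2.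
pose proof (beta_Gamma_INR a m Ha) as r1.
pose proof (beta_Gamma_INR a (S m) Ha) as r2. rewrite S_INR in r2.
pose proof (Gamma_pos a ltac:(lra)) as HG.
assert (Hq0 : 0 < Gamma (INR m + a + 1) / Gamma (INR m + 1))
  by (apply Rdiv_lt_0_compat; apply Gamma_pos; lra).
assert (Hq : Gamma (INR m + 1 + a + 1) / Gamma (INR m + 1 + 1) =
  (1 + a / (INR m + 1)) * (Gamma (INR m + a + 1) / Gamma (INR m + 1))).
{ replace (INR m + 1 + a + 1) with (INR m + a + 1 + 1) by ring.
  rewrite 2!Gamma_succ by lra. pose proof (Gamma_pos (INR m) Hm). field. lra. }
unfold Rdiv at 1. rewrite Rmult_assoc.
fold (Gamma (c + a + 1) / Gamma (c + 1)).
rewrite Hq in q2, r2.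
set (e := a / (INR m + 1)) in *.
assert (He : 0 < e) by (apply Rdiv_lt_0_compat; lra).
set (Q := Gamma (c + a + 1) / Gamma (c + 1)) in *.
set (q := Gamma (INR m + a + 1) / Gamma (INR m + 1)) in *.
set (G := Gamma (a + 1)) in *.
set (K := beta_int (/ a) c) in *.
assert (HK' : 0 <= beta_int (/ a) (INR m + 1)) by nra.
assert (U : K * Q <= beta_int (/ a) (INR m) * ((1 + e) * q)).
{ apply Rmult_le_compat; lra. }
assert (L : beta_int (/ a) (INR m + 1) * q <= K * Q).
{ apply Rmult_le_compat; lra. }
apply Rabs_le. split.
(* The lower bound equals [G / (1 + e)], which is at least [(1 - e) G] because
   [(1 - e) (1 + e) <= 1]. *)
- assert ((1 - e) * (beta_int (/ a) (INR m + 1) * ((1 + e) * q))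
          <= beta_int (/ a) (INR m + 1) * q).
  { assert (0 <= beta_int (/ a) (INR m + 1) * q) by (apply Rmult_le_pos; lra). nra. }
  rewrite r2 in H. lra.
- replace (beta_int (/ a) (INR m) * ((1 + e) * q))
    with ((1 + e) * (beta_int (/ a) (INR m) * q)) in U by ring.
  rewrite r1 in U. lra.
Qed.

(* [r c = beta_int (1/a) c * Gamma (c+a+1) / Gamma (c+1)] is 1-periodic; monotonicity of its two
   factors and the known integer values give [r (c + n) -> Gamma (a+1)]. *)
Lemma beta_Gamma (a c : R) :
  0 < a -> 0 <= c ->
  beta_int (/ a) c * Gamma (c + a + 1) = Gamma (a + 1) * Gamma (c + 1).
Proof.
intros Ha Hc.
pose proof (Gamma_pos c Hc) as HG. pose proof (Gamma_pos a ltac:(lra)) as HGa.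
enough (H : beta_int (/ a) c * Gamma (c + a + 1) / Gamma (c + 1) = Gamma (a + 1)).
{ rewrite <- H. field. lra. }
apply Rminus_diag_uniq, Rabs_eq_0.
apply Rle_antisym; [| apply Rabs_pos].
apply Rnot_lt_le. intros Hpos.
set (D := Rabs _) in Hpos.
destruct (nfloor_ex c Hc) as [m Hm].
(* By periodicity the defect [D] is the same at [c + n], where the sandwich yields
   [D (m + n + 1) <= Gamma (a + 1) a]; this [n] is too large for that. *)
destruct (INR_unbounded (Gamma (a + 1) * a / D)) as [n Hn].
pose proof (beta_Gamma_sandwich a (c + INR n) (m + n) Ha) as H.
rewrite beta_Gamma_shift in H by assumption. fold D in H.
rewrite plus_INR in H. specialize (H ltac:(lra)).
pose proof (pos_INR m). pose proof (pos_INR n).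
apply Rlt_div_l in Hn; [| exact Hpos].
unfold Rdiv in H. rewrite <- Rmult_assoc in H.
apply Rle_div_r in H; [| lra]. nra.
Qed.

(** * Terms of the series and their fractional integrals *)

Definition ml_term (a : R) (n : nat) (t : R) : R := rpow0 t (a * INR n) / Gamma (a * INR n + 1).

Definition ml_conv (a : R) (n : nat) (x y : R) : R :=
  sum_f_R0 (fun j => ml_term a j x * ml_term a (n - j) y) n.

Lemma mult_INR_ge_0 (a : R) (n : nat) : 0 < a -> 0 <= a * INR n.
Proof. intros Ha. apply Rmult_le_pos; [lra | apply pos_INR]. Qed.

Lemma ML_series (a t : R) : 0 < a -> ML a (rpow t a) = Series (fun n => ml_term a n t).
Proof.
intros Ha. apply Series_ext. intros n. unfold ml_term. now rewrite rpow_pow.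
Qed.

Lemma ml_term_0 (a t : R) : ml_term a 0 t = 1.
Proof.
unfold ml_term, rpow0. simpl. rewrite Rmult_0_r, Rplus_0_l, Gamma_1.
destruct (Req_EM_T 0 0); lra.
Qed.

Lemma ml_term_ge_0 (a t : R) (n : nat) : 0 < a -> 0 <= ml_term a n t.
Proof.
intros Ha. apply Rdiv_le_0_compat; [apply rpow0_ge_0 |].
now apply Gamma_pos, mult_INR_ge_0.
Qed.

Lemma ml_term_le (a s t : R) (n : nat) : 0 < a -> s <= t -> ml_term a n s <= ml_term a n t.
Proof.
intros Ha Hst. pose proof (mult_INR_ge_0 a n Ha) as Hn.
apply Rmult_le_compat_r.
- now apply Rlt_le, Rinv_0_lt_compat, Gamma_pos.
- now apply rpow0_le.
Qed.

Lemma continuous_ml_term (a t : R) (n : nat) : 0 < a -> continuous (ml_term a n) t.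
Proof.
intros Ha. apply (continuous_mult (K := R_AbsRing)).
- now apply continuous_rpow0, mult_INR_ge_0.
- apply continuous_const.
Qed.

Lemma continuous_ml_term_rpow (a b s k v : R) (n : nat) :
  0 < a -> 0 < b -> continuous (fun v => ml_term a n (s - rpow (k + v) b)) v.
Proof.
intros Ha Hb. apply continuous_comp with (g := ml_term a n).
- apply (continuous_minus (V := R_NormedModule)); [apply continuous_const |].
  apply continuous_comp with (g := fun u => rpow u b).
  + apply (continuous_plus (V := R_NormedModule)); [apply continuous_const | apply continuous_id].
  + now apply continuous_rpow.
- now apply continuous_ml_term.
Qed.

Lemma ex_RInt_ml_term_rpow (a b s u v : R) (n : nat) :
  0 < a -> 0 < b -> ex_RInt (fun v => ml_term a n (s - rpow v b)) u v.
Proof.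
intros Ha Hb. apply (ex_RInt_continuous (V := R_CompleteNormedModule)). intros z _.
apply (continuous_ext (fun v => ml_term a n (s - rpow (0 + v) b))).
- intros w. now rewrite Rplus_0_l.
- now apply continuous_ml_term_rpow.
Qed.

(* Riemann-Liouville integration of order [a], after substituting [v = (t - s)^a], which
   removes the singularity of the kernel [(t - s)^(a-1)]. *)
Lemma ml_term_succ (a t : R) (n : nat) :
  0 < a -> 0 <= t ->
  Gamma (a + 1) * ml_term a (S n) t =
  RInt (fun v => ml_term a n (t - rpow v (/ a))) 0 (rpow t a).
Proof.
intros Ha Ht. assert (Hb : 0 < / a) by now apply Rinv_0_lt_compat.
pose proof (mult_INR_ge_0 a n Ha) as Hn.
assert (HaS : a * INR (S n) = a * INR n + a) by (rewrite S_INR; ring).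
destruct Ht as [Ht | <-].
- pose proof (rpow_gt_0 t a Ht) as HT.
  set (f := fun v => ml_term a n (t - rpow v (/ a))).
  (* Substituting [v = t^a w] takes out the factor [t^a p_n(t)] and leaves the beta integrand on
     [[0, 1]]. *)
  pose proof (RInt_comp_lin (V := R_CompleteNormedModule) f (rpow t a) 0 0 1) as H.
  rewrite Rmult_0_r, Rmult_1_r, !Rplus_0_r in H.
  rewrite <- H by now apply ex_RInt_ml_term_rpow.
  rewrite (RInt_ext (V := R_CompleteNormedModule)) with
    (g := fun w => scal (rpow t a * ml_term a n t) (rpow0 (1 - rpow w (/ a)) (a * INR n))).
  + rewrite (RInt_scal (V := R_CompleteNormedModule)) by now apply ex_RInt_beta_integrand.
    fold (beta_int (/ a) (a * INR n)). unfold scal; simpl; unfold mult; simpl.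
    pose proof (beta_Gamma a (a * INR n) Ha Hn) as HB.
    pose proof (Gamma_pos (a * INR n) Hn).
    pose proof (Gamma_pos (a * INR n + a) ltac:(lra)).
    unfold ml_term. rewrite HaS.
    rewrite 2!rpow0_pos, rpow_pos by exact Ht. rewrite Rpower_plus.
    replace (beta_int (/ a) (a * INR n))
      with (Gamma (a + 1) * Gamma (a * INR n + 1) / Gamma (a * INR n + a + 1))
      by (rewrite <- HB; field; lra).
    field. lra.
  + intros w _. unfold f, scal; simpl; unfold mult; simpl.
    rewrite Rplus_0_r, rpow_mult_l, rpow_rpow_inv by lra.
    replace (t - t * rpow w (/ a)) with (t * (1 - rpow w (/ a))) by ring.
    unfold ml_term. rewrite rpow0_mult_l by exact Ht. unfold Rdiv. ring.
- rewrite (rpow_nonpos 0) by lra. rewrite RInt_point.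
  unfold ml_term, rpow0. destruct (Req_EM_T (a * INR (S n)) 0); [lra |].
  rewrite rpow_nonpos by lra. unfold zero; simpl. unfold Rdiv. ring.
Qed.

(** The integral is cut at [v = y^a]. The first piece is grouped as [x + (y - v^(1/a))] to suit the
    induction hypothesis; the second is translated to start at 0, to face the integral of
    [p_n(x - u^(1/a))] over [[0, x^a]]. *)
Lemma ml_term_succ_plus (a x y : R) (n : nat) :
  0 < a -> 0 <= x -> 0 <= y ->
  Gamma (a + 1) * ml_term a (S n) (x + y) =
  RInt (fun v => ml_term a n (x + (y - rpow v (/ a)))) 0 (rpow y a) +
  RInt (fun u => ml_term a n (x + y - rpow (rpow y a + u) (/ a))) 0 (rpow (x + y) a - rpow y a).
Proof.
intros Ha Hx Hy. assert (Hb : 0 < / a) by now apply Rinv_0_lt_compat.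
rewrite ml_term_succ by lra.
rewrite <- (RInt_Chasles (V := R_CompleteNormedModule) _ 0 (rpow y a))
  by now apply ex_RInt_ml_term_rpow.
unfold plus; simpl. f_equal.
- apply RInt_ext. intros v _. f_equal. ring.
- pose proof (RInt_comp_lin (V := R_CompleteNormedModule)
    (fun v => ml_term a n (x + y - rpow v (/ a))) 1 (rpow y a) 0
    (rpow (x + y) a - rpow y a)) as H.
  replace (1 * 0 + rpow y a) with (rpow y a) in H by ring.
  replace (1 * (rpow (x + y) a - rpow y a) + rpow y a) with (rpow (x + y) a) in H by ring.
  rewrite <- H by now apply ex_RInt_ml_term_rpow.
  apply RInt_ext. intros u _. unfold scal; simpl; unfold mult; simpl.
  rewrite Rmult_1_l. do 3 f_equal. ring.
Qed.

Lemma is_RInt_sum_f_R0 (f : nat -> R -> R) (l : nat -> R) (u v : R) (n : nat) :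
  (forall j, (j <= n)%nat -> is_RInt (f j) u v (l j)) ->
  is_RInt (fun t => sum_f_R0 (fun j => f j t) n) u v (sum_f_R0 l n).
Proof.
induction n as [| n IH]; intros H; simpl.
- now apply H.
- apply (is_RInt_plus (V := R_NormedModule)).
  + apply IH. intros j Hj. apply H. lia.
  + now apply H.
Qed.

(** The term [j = n + 1] is set apart: its factor in [y] is [p_0 = 1], which does not arise by
    fractional integration. *)
Lemma ml_conv_succ (a x y : R) (n : nat) :
  ml_conv a (S n) x y =
  sum_f_R0 (fun j => ml_term a j x * ml_term a (S (n - j)) y) n + ml_term a (S n) x.
Proof.
unfold ml_conv. rewrite tech5, Nat.sub_diag, ml_term_0, Rmult_1_r. f_equal.
apply sum_eq. intros j Hj. do 2 f_equal. lia.
Qed.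

(** Integration in the second variable raises the index of each [p_(n-j)(y)] by one, which gives the
    product of order [n + 1] without its last term. *)
Lemma is_RInt_ml_conv (a x y : R) (n : nat) :
  0 < a -> 0 <= y ->
  is_RInt (fun v => ml_conv a n x (y - rpow v (/ a))) 0 (rpow y a)
    (Gamma (a + 1) * (ml_conv a (S n) x y - ml_term a (S n) x)).
Proof.
intros Ha Hy. assert (Hb : 0 < / a) by now apply Rinv_0_lt_compat.
rewrite ml_conv_succ, Rplus_minus_r, scal_sum.
apply (is_RInt_sum_f_R0 (fun j v => ml_term a j x * ml_term a (n - j) (y - rpow v (/ a)))).
intros j _. evar_last.
- apply (is_RInt_scal (V := R_NormedModule)), (RInt_correct (V := R_CompleteNormedModule)).
  now apply ex_RInt_ml_term_rpow.
- rewrite <- ml_term_succ by assumption. unfold scal; simpl; unfold mult; simpl. ring.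
Qed.

Lemma ex_RInt_ml_term_sub_rpow (a x y : R) (n : nat) :
  0 < a -> 0 <= y -> ex_RInt (fun v => ml_term a n (x + (y - rpow v (/ a)))) 0 (rpow y a).
Proof.
intros Ha Hy. apply ex_RInt_ext with (fun v => ml_term a n (x + y - rpow v (/ a))).
- intros v _. f_equal. ring.
- now apply ex_RInt_ml_term_rpow, Rinv_0_lt_compat.
Qed.

Lemma ex_RInt_ml_term_rpow_shift (a s k u v : R) (n : nat) :
  0 < a -> ex_RInt (fun u => ml_term a n (s - rpow (k + u) (/ a))) u v.
Proof.
intros Ha. apply (ex_RInt_continuous (V := R_CompleteNormedModule)). intros z _.
now apply continuous_ml_term_rpow, Rinv_0_lt_compat.
Qed.

Lemma rpow_inv_sub_ge_0 (a y v : R) : 0 < a -> 0 <= y -> v <= rpow y a -> 0 <= y - rpow v (/ a).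
Proof.
intros Ha Hy Hv.
pose proof (rpow_le v (rpow y a) (/ a) (Rlt_le _ _ (Rinv_0_lt_compat a Ha)) Hv) as H.
rewrite rpow_rpow_inv in H by assumption. lra.
Qed.

(** * Term-by-term comparison *)

(** [y] stays general because the induction hypothesis is used at [y - v^(1/a)]. In the second
    piece, subadditivity of [t^a] bounds the length [(x + y)^a - y^a] by [x^a], and superadditivity
    of [t^(1/a)] gives [(y^a + u)^(1/a) >= y + u^(1/a)], so the integrand is at most
    [p_n(x - u^(1/a))]. *)
Lemma ml_term_le_conv (a x y : R) (n : nat) :
  0 < a < 1 -> 0 <= x -> 0 <= y -> ml_term a n (x + y) <= ml_conv a n x y.
Proof.
intros Ha Hx. revert y. induction n as [| n IH]; intros y Hy.
- unfold ml_conv. simpl. rewrite !ml_term_0. lra.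
- assert (Hb : 1 < / a) by (rewrite <- Rinv_1; apply Rinv_lt_contravar; lra).
  apply Rmult_le_reg_l with (Gamma (a + 1)); [apply Gamma_pos; lra |].
  rewrite ml_term_succ_plus by lra.
  pose proof (is_RInt_ml_conv a x y n ltac:(lra) Hy) as HI.
  apply Rle_trans with (Gamma (a + 1) * (ml_conv a (S n) x y - ml_term a (S n) x) +
                        Gamma (a + 1) * ml_term a (S n) x); [| lra].
  pose proof (rpow_le y (x + y) a ltac:(lra) ltac:(lra)) as Hxy.
  pose proof (rpow_subadditive x y a ltac:(lra) Hx Hy) as Hsub.
  apply Rplus_le_compat.
  + rewrite <- (is_RInt_unique _ _ _ _ HI).
    apply RInt_le; [apply rpow_ge_0 | apply ex_RInt_ml_term_sub_rpow; lra | now eexists; exact HI |].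
    intros v Hv. apply IH. apply rpow_inv_sub_ge_0; lra.
  + rewrite ml_term_succ by lra.
    apply Rle_trans with (RInt (fun u => ml_term a n (x - rpow u (/ a))) 0
                               (rpow (x + y) a - rpow y a)).
    * apply RInt_le; [lra | apply ex_RInt_ml_term_rpow_shift; lra | apply ex_RInt_ml_term_rpow; lra |].
      intros u Hu. apply ml_term_le; [lra |].
      pose proof (rpow_superadditive (rpow y a) u (/ a) Hb (rpow_ge_0 _ _) ltac:(lra)) as H.
      rewrite rpow_rpow_inv in H by lra. lra.
    * rewrite <- (RInt_Chasles (V := R_CompleteNormedModule) _ 0
        (rpow (x + y) a - rpow y a) (rpow x a)) by (apply ex_RInt_ml_term_rpow; lra).
      assert (0 <= RInt (fun u => ml_term a n (x - rpow u (/ a)))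
                     (rpow (x + y) a - rpow y a) (rpow x a)).
      { apply RInt_ge_0; [lra | apply ex_RInt_ml_term_rpow; lra |].
        intros; apply ml_term_ge_0; lra. }
      unfold plus; simpl. lra.
Qed.

(** The mirror image for [1/a < 1 < a]: the second piece now has length at least [x^a], its
    integrand is at least [p_n(x - u^(1/a))] on [[0, x^a]], and the part beyond [x^a] is
    nonnegative. *)
Lemma ml_conv_le_term (a x y : R) (n : nat) :
  1 < a -> 0 <= x -> 0 <= y -> ml_conv a n x y <= ml_term a n (x + y).
Proof.
intros Ha Hx. revert y. induction n as [| n IH]; intros y Hy.
- unfold ml_conv. simpl. rewrite !ml_term_0. lra.
- assert (Hb : 0 < / a) by (apply Rinv_0_lt_compat; lra).
  assert (Hb1 : / a < 1) by (rewrite <- Rinv_1; apply Rinv_lt_contravar; lra).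
  apply Rmult_le_reg_l with (Gamma (a + 1)); [apply Gamma_pos; lra |].
  rewrite ml_term_succ_plus by lra.
  pose proof (is_RInt_ml_conv a x y n ltac:(lra) Hy) as HI.
  apply Rle_trans with (Gamma (a + 1) * (ml_conv a (S n) x y - ml_term a (S n) x) +
                        Gamma (a + 1) * ml_term a (S n) x); [lra |].
  pose proof (rpow_ge_0 x a) as Hxa.
  pose proof (rpow_superadditive x y a ltac:(lra) Hx Hy) as Hsup.
  apply Rplus_le_compat.
  + rewrite <- (is_RInt_unique _ _ _ _ HI).
    apply RInt_le; [apply rpow_ge_0 | now eexists; exact HI | apply ex_RInt_ml_term_sub_rpow; lra |].
    intros v Hv. apply IH. apply rpow_inv_sub_ge_0; lra.
  + rewrite ml_term_succ by lra.
    apply Rle_trans with (RInt (fun u => ml_term a n (x + y - rpow (rpow y a + u) (/ a))) 0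
                               (rpow x a)).
    * apply RInt_le; [lra | apply ex_RInt_ml_term_rpow; lra | apply ex_RInt_ml_term_rpow_shift; lra |].
      intros u Hu. apply ml_term_le; [lra |].
      pose proof (rpow_subadditive (rpow y a) u (/ a) Hb1 (rpow_ge_0 _ _) ltac:(lra)) as H.
      rewrite rpow_rpow_inv in H by lra. lra.
    * rewrite <- (RInt_Chasles (V := R_CompleteNormedModule) _ 0
        (rpow x a) (rpow (x + y) a - rpow y a)) by (apply ex_RInt_ml_term_rpow_shift; lra).
      assert (0 <= RInt (fun u => ml_term a n (x + y - rpow (rpow y a + u) (/ a)))
                     (rpow x a) (rpow (x + y) a - rpow y a)).
      { apply RInt_ge_0; [lra | apply ex_RInt_ml_term_rpow_shift; lra |].
        intros; apply ml_term_ge_0; lra. }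
      unfold plus; simpl. lra.
Qed.

(** * The strict term, convergence and summation *)

Lemma ml_term_1 (a t : R) : 0 < a -> ml_term a 1 t = rpow t a / Gamma (a + 1).
Proof.
intros Ha. unfold ml_term, rpow0. simpl. rewrite Rmult_1_r.
destruct (Req_EM_T a 0); [lra | reflexivity].
Qed.

Lemma ml_conv_1 (a x y : R) :
  0 < a -> ml_conv a 1 x y = (rpow x a + rpow y a) / Gamma (a + 1).
Proof.
intros Ha. unfold ml_conv. simpl. rewrite !ml_term_0, !ml_term_1 by exact Ha.
unfold Rdiv. ring.
Qed.

(** With [A^(a n) = s^(a n) 2^n], [Gamma_lower] at [A] dominates the series by a geometric one of
    ratio 1/2. *)
Lemma ex_series_ml_term (a t : R) : 0 < a -> ex_series (fun n => ml_term a n t).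
Proof.
intros Ha.
(* By monotonicity [t] may be replaced by some [s >= 1], a positive base to which the rules for
   [Rpower] apply. *)
pose (s := Rmax t 1). assert (Hs : 1 <= s) by apply Rmax_r.
pose (A := s * Rpower 2 (/ a)).
assert (HA : 0 < A) by (apply Rmult_lt_0_compat; [lra | apply exp_pos]).
apply (ex_series_le (K := R_AbsRing) (V := R_CompleteNormedModule) _
  (fun n => exp (A + 1) * (/ 2) ^ n)).
- intros n. pose proof (mult_INR_ge_0 a n Ha) as Hn.
  unfold norm; simpl; unfold abs; simpl.
  rewrite Rabs_pos_eq by now apply ml_term_ge_0.
  apply Rle_trans with (ml_term a n s); [apply ml_term_le; [exact Ha | apply Rmax_l] |].
  apply Rle_div_l; [now apply Gamma_pos |].
  apply Rle_trans with (exp (A + 1) * (/ 2) ^ n * (Rpower A (a * INR n) * exp (- (A + 1)))).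
  + apply Req_le. rewrite rpow0_pos by lra.
    unfold A. rewrite <- Rpower_mult_distr by (lra || apply exp_pos).
    rewrite Rpower_mult. replace (/ a * (a * INR n)) with (INR n) by (field; lra).
    rewrite Rpower_pow, pow_inv, exp_Ropp by lra.
    field. split; [apply Rgt_not_eq, exp_pos | apply pow_nonzero; lra].
  + apply Rmult_le_compat_l.
    * apply Rmult_le_pos; [apply Rlt_le, exp_pos | apply pow_le; lra].
    * now apply Gamma_lower.
- apply (ex_series_scal (K := R_AbsRing) (V := R_NormedModule)).
  apply ex_series_geom. rewrite Rabs_pos_eq; lra.
Qed.

(** Cauchy's product theorem; absolute convergence is plain convergence here, the terms being
    nonnegative. *)
Lemma is_series_ml_conv (a x y : R) :
  0 < a -> is_series (fun n => ml_conv a n x y) (ML a (rpow x a) * ML a (rpow y a)).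
Proof.
intros Ha. rewrite 2!ML_series by exact Ha.
assert (Habs : forall t, ex_series (fun n => Rabs (ml_term a n t))).
{ intros t. apply ex_series_ext with (fun n => ml_term a n t).
  - intros n. symmetry. now apply Rabs_pos_eq, ml_term_ge_0.
  - now apply ex_series_ml_term. }
apply (is_series_mult (fun n => ml_term a n x) (fun n => ml_term a n y));
  try apply Habs; now apply Series_correct, ex_series_ml_term.
Qed.

(** The differences are nonnegative, so their sum is at least the partial sum up to [k], which
    contains [v k - u k > 0]. *)
Lemma Series_lt (u v : nat -> R) (k : nat) :
  ex_series u -> ex_series v -> (forall n, u n <= v n) -> u k < v k -> Series u < Series v.
Proof.
intros Hu Hv Hle Hk.
pose (w := fun n => v n - u n).
assert (Hw : ex_series w) by (apply (ex_series_minus (V := R_NormedModule)); assumption).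
assert (Hw0 : forall n, 0 <= w n) by (intros n; unfold w; pose proof (Hle n); lra).
assert (Hpos : 0 < Series w).
{ apply Rlt_le_trans with (sum_f_R0 w k).
  - destruct k as [| k]; simpl; [unfold w; lra |].
    pose proof (cond_pos_sum w k Hw0). unfold w at 2. lra.
  - rewrite <- sum_n_Reals. apply Series_correct in Hw.
    apply is_lim_seq_incr_compare; [exact Hw |].
    intros n. rewrite sum_Sn. unfold plus; simpl. pose proof (Hw0 (S n)). lra. }
unfold w in Hpos. rewrite Series_minus in Hpos by assumption. lra.
Qed.

Theorem theorem1p1 : forall alpha : R,
  (0 < alpha < 1 ->
     (forall x y, 0 <= x -> 0 <= y ->
        ML alpha (rpow (x + y) alpha) <= ML alpha (rpow x alpha) * ML alpha (rpow y alpha)) /\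
     (forall x y, 0 < x -> 0 < y ->
        ML alpha (rpow (x + y) alpha) < ML alpha (rpow x alpha) * ML alpha (rpow y alpha))) /\
  (1 < alpha ->
     (forall x y, 0 <= x -> 0 <= y ->
        ML alpha (rpow (x + y) alpha) >= ML alpha (rpow x alpha) * ML alpha (rpow y alpha)) /\
     (forall x y, 0 < x -> 0 < y ->
        ML alpha (rpow (x + y) alpha) > ML alpha (rpow x alpha) * ML alpha (rpow y alpha))).
Proof.
intros a.
assert (HS : forall x y, 0 < a -> ex_series (fun n => ml_conv a n x y) /\
  ML a (rpow x a) * ML a (rpow y a) = Series (fun n => ml_conv a n x y)).
{ intros x y Ha. pose proof (is_series_ml_conv a x y Ha) as H. split.
  - eexists; exact H.
  - symmetry. now apply is_series_unique. }
split; intros Ha; (assert (Ha0 : 0 < a) by lra); split; intros x y Hx Hy;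
  destruct (HS x y Ha0) as [Hc ->]; rewrite ML_series by exact Ha0;
  pose proof (ex_series_ml_term a (x + y) Ha0) as Ht.
- apply Series_le; [| exact Hc]. intros n. split; [now apply ml_term_ge_0 |].
  now apply ml_term_le_conv.
(* At [n = 0] both terms are 1; [n = 1] is the first strict index, by strict subadditivity of
   [t^a]. *)
- apply Series_lt with 1%nat; [exact Ht | exact Hc | |].
  + intros n. apply ml_term_le_conv; lra.
  + rewrite ml_term_1, ml_conv_1 by exact Ha0.
    apply Rmult_lt_compat_r; [apply Rinv_0_lt_compat, Gamma_pos; lra |].
    apply rpow_subadditive_lt; lra.
- apply Rle_ge, Series_le; [| exact Ht]. intros n. split; [| now apply ml_conv_le_term].
  apply cond_pos_sum. intros j. now apply Rmult_le_pos; apply ml_term_ge_0.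
- apply Rlt_gt, Series_lt with 1%nat; [exact Hc | exact Ht | |].
  + intros n. apply ml_conv_le_term; lra.
  + rewrite ml_term_1, ml_conv_1 by exact Ha0.
    apply Rmult_lt_compat_r; [apply Rinv_0_lt_compat, Gamma_pos; lra |].
    apply rpow_superadditive_lt; lra.
Qed.
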